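(* Let $t>0$, $M>0$, $m\geq1$, and let $y_{2m,1}(t),\dots,y_{2m,2m}(t)$ be the zeros of $Q_{2m}^t(x)$. Put $$u(x,t;2m)=4b_{2m}^tx^4+4x^2\left(\left[a_{2m}^2(t)b_{2m}^t-t\right]b_{2m}^t+a_{2m+1}^2(t)\right)+h_{2m}^t,$$ $$h_{2m}^t=\left(4a_{2m}^2(t)\left[a_{2m}^2(t)+a_{2m-1}^2(t)-t\right]\left[b_{2m}^t-1\right]-1\right)\left(b_{2m}^t-1\right).$$ Then, for every $i=1,\dots,2m$, the electrostatic equilibrium condition $$\sum_{j=1,\,j\neq i}^{2m}\frac{1}{y_{2m,j}(t)-y_{2m,i}(t)}+\frac12\,\frac{u'\left(y_{2m,i}(t),t;2m\right)}{u\left(y_{2m,i}(t),t;2m\right)}-\frac{1}{y_{2m,i}(t)}+2\left(y_{2m,i}^3(t)-t\,y_{2m,i}(t)\right)=0$$ holds, where $u'$ denotes the derivative of $u$ with respect to $x$.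
   Context: For polynomials with real coefficients put $\langle p,q\rangle_t=\int_{\mathbb{R}}p(x)q(x)e^{-x^4+2tx^2}dx$ and $\|p\|_t^2=\langle p,p\rangle_t$. $\{F_n^t\}_{n\geq0}$ is the sequence of monic polynomials ($\deg F_n^t=n$) orthogonal with respect to $\langle\cdot,\cdot\rangle_t$; it satisfies $xF_n^t(x)=F_{n+1}^t(x)+a_n^2(t)F_{n-1}^t(x)$ with $F_{-1}^t=0$, $F_0^t=1$, $a_0^2(t)=0$, and $a_n^2(t)=\|F_n^t\|_t^2/\|F_{n-1}^t\|_t^2>0$ for $n\ge1$. The kernel is $K_n(x,y;t)=\sum_{k=0}^n F_k^t(x)F_k^t(y)/\|F_k^t\|_t^2$. $\{Q_n^t\}_{n\geq0}$ is the sequence of monic polynomials ($\deg Q_n^t=n$) orthogonal with respect to $\langle p,q\rangle=\langle p,q\rangle_t+Mp(0)q(0)$; the zeros of $Q_n^t$ are real and simple. Put $b_n^t=\dfrac{1+MK_n(0,0;t)}{1+MK_{n-1}(0,0;t)}$ for $n\ge 1$. *)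

(* Defs.v *)
From HB Require Import structures.
From mathcomp Require Import all_boot all_order all_algebra.
From mathcomp Require Import all_classical all_reals all_analysis.

Set Implicit Arguments.
Unset Strict Implicit.
Unset Printing Implicit Defensive.

Import Order.TTheory GRing.Theory Num.Theory.

Local Open Scope ring_scope.

Section Definitions.
Variable R : realType.
Implicit Types (t M x y : R) (p q : {poly R}) (F : nat -> {poly R}).

Definition ip t p q : R :=
  \int[lebesgue_measure]_x (p.[x] * q.[x] * expR (- x ^+ 4 + 2 * t * x ^+ 2)).

Definition sqnorm t p : R := ip t p p.

Definition ip_mass t M p q : R := ip t p q + M * p.[0] * q.[0].

(* These conditions determine F uniquely when B is an inner product on
   polynomials: size p is deg p + 1. *)
Definition monic_orthogonal (B : {poly R} -> {poly R} -> R) F : Prop :=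
  (forall n, F n \is monic /\ size (F n) = n.+1) /\
  (forall k n, k != n -> B (F k) (F n) = 0).

(* The remaining definitions take F to be the monic orthogonal sequence for
   ip t. *)

(* This is a_n^2(t), not a_n(t). *)
Definition asq t F n : R :=
  if n is k.+1 then sqnorm t (F k.+1) / sqnorm t (F k) else 0.

Definition kernel t F n x y : R :=
  \sum_(k < n.+1) (F k).[x] * (F k).[y] / sqnorm t (F k).

(* Meaningful for n >= 1 only, because of n.-1. *)
Definition bcoef t M F n : R :=
  (1 + M * kernel t F n 0 0) / (1 + M * kernel t F n.-1 0 0).

Definition hcoef t M F n : R :=
  (4 * asq t F n * (asq t F n + asq t F n.-1 - t) * (bcoef t M F n - 1) - 1)
  * (bcoef t M F n - 1).

Definition upoly t M F n : {poly R} :=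
  (4 * bcoef t M F n) *: 'X^4
  + (4 * ((asq t F n * bcoef t M F n - t) * bcoef t M F n + asq t F n.+1)) *: 'X^2
  + (hcoef t M F n)%:P.

End Definitions.

(* Main.v *)
Require Import Defs.
From HB Require Import structures.
From mathcomp Require Import all_boot all_order all_algebra.
From mathcomp Require Import all_classical all_reals all_analysis.
From mathcomp Require Import measurable_realfun ring lra.
From mathcomp Require finmap.

Import Order.TTheory GRing.Theory Num.Theory.
Import numFieldNormedType.Exports.
Local Open Scope ring_scope.

(** The zeros of Q_n, for n = 2m, are those zeros of G = x Q_n that differ from
the origin, and the equilibrium condition is the value at such a zero of a
second order differential equation for G.

Everything takes place in the space spanned over the polynomials by F_n and
F_(n-1).  Integration by parts against the weight exp(-x^4 + 2 t x^2) and the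
three-term recurrence give a first order linear system for this pair (lemma
[ladder]) whose matrix has trace V' = 4 x^3 - 4 t x.  Adding the mass M at the
origin changes F_n by a multiple of K_(n-1)(x,0).  For even n the
Christoffel-Darboux formula at the origin involves F_(n-1) only, because
F_(n-1)(0) = 0, and so
  x Q_n = x F_n + a_n^2 (b_n - 1) F_(n-1)
(lemma [connection_formula]).

Let W be the determinant of the coefficients of G and G' on F_n and F_(n-1).
Abel's formula for the system yields
  W G'' = (V' W + W') G'   wherever G = 0
(lemma [wronskian_at_root]), and expanding the determinant gives W = a_n^2 u.
At a zero y of Q_n, where G' = y Q_n' and G'' = y Q_n'' + 2 Q_n', this reads
  Q_n''/Q_n' + 2/y = V' + u'/u,
and Q_n''/Q_n' is twice the sum of the 1/(y - y_j) over the other zeros y_j.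

The quotients make sense because Q_n has simple zeros, since a double zero would
make some square of a nonzero polynomial have zero integral; because
Q_n(0) (1 + M K_(n-1)(0,0)) = F_n(0) is not zero; and because y G' = W F_(n-1)
at y, with G' nonzero there, forces u(y) to be nonzero.

The algebra only uses that p |-> int p w is linear, positive on squares,
invariant under x |-> -x, and maps p' and V' p to the same number.  Hence it is
carried out for an abstract functional with these properties. *)

(** * Polynomials against the weight *)

Section Weight.
Context {R : realType}.
Variable t : R.
Implicit Types (p q : {poly R}) (x : R).
Local Notation mu := (@lebesgue_measure R).

Definition weight (x : R) : R := expR (- x ^+ 4 + 2 * t * x ^+ 2).

Definition weighted p (x : R) : R := p.[x] * weight x.

(** The crude factor 1 + k! comes from |x|^k <= 1 + x^(2k) and from one term of
the exponential series at x^2. *)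
Lemma powerR_le_expR_sqr k x : `|x| ^+ k <= (1 + k`!%:R) * expR (x ^+ 2).
Proof.
have le1 : 1 <= expR (x ^+ 2) by rewrite -expR0 ler_expR sqr_ge0.
have lek : (x ^+ 2) ^+ k <= k`!%:R * expR (x ^+ 2).
  case: k => [|k]; first by rewrite expr0 mul1r.
  rewrite mulrC -ler_pdivrMr ?ltr0n ?fact_gt0//.
  apply: le_trans (expR_ge1Dxn k (sqr_ge0 x)).
  by rewrite lerDr.
rewrite mulrDl mul1r; apply: le_trans (lerD le1 lek).
rewrite -exprM mulnC exprM -(real_normK (num_real (x ^+ k))) normrX.
by nra.
Qed.

Lemma horner_le_expR_sqr p : exists C : R, forall x, `|p.[x]| <= C * expR (x ^+ 2).
Proof.
exists (\sum_(i < size p) `|p`_i| * (1 + i`!%:R)) => x.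
rewrite horner_coef mulr_suml; apply: le_trans (ler_norm_sum _ _ _) _.
apply: ler_sum => i _; rewrite normrM normrX -mulrA.
by apply: ler_wpM2l => //; exact: powerR_le_expR_sqr.
Qed.

(** The quartic exponent absorbs both the growth exp(x^2) of the polynomial and
the factor exp(2 t x^2): integrability and decay of every p w reduce to the
Gaussian case. *)
Lemma weighted_le_gauss p :
  exists C : R, forall x, `|weighted p x| <= C * gauss_fun x.
Proof.
have [C hC] := horner_le_expR_sqr p.
exists (C * expR ((t + 1) ^+ 2)) => x.
rewrite /weighted normrM [`|weight x|]ger0_norm ?expR_ge0//.
have C0 : 0 <= C by have := le_trans (normr_ge0 _) (hC 0); rewrite pmulr_lge0 ?expR_gt0.
apply: (@le_trans _ _ (C * expR (x ^+ 2) * weight x)).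
  by rewrite ler_wpM2r ?expR_ge0.
rewrite -!mulrA ler_wpM2l// -!expRD ler_expR.
(* - x^4 + (2 t + 2) x^2 <= (t + 1)^2 *)
by have := sqr_ge0 (x ^+ 2 - (t + 1)); nra.
Qed.

Lemma weightE : weight = expR \o horner (- 'X^4 + (2 * t) *: 'X^2).
Proof. by apply/funext => x; rewrite /weight /= !hornerE. Qed.

Lemma continuous_weighted p : continuous (weighted p).
Proof.
move=> x; apply: continuousM; first exact: continuous_horner.
rewrite weightE; apply: continuous_comp; first exact: continuous_horner.
exact: continuous_expR.
Qed.

Lemma integrable_weighted p : mu.-integrable setT (EFin \o weighted p).
Proof.
have [C hC] := weighted_le_gauss p.
have ig : mu.-integrable setT (fun x => (C%:E * (EFin \o gauss_fun) x)%E).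
  by apply: integrableZl => //; exact: integrableT_gauss.
apply: le_integrable ig => //.
  by apply/measurable_EFinP; apply: continuous_measurable_fun; exact: continuous_weighted.
by move=> x _ /=; rewrite lee_fin; apply: le_trans (hC x) _; exact: ler_norm.
Qed.

(** Here e is 1 or -1, so that both boundary terms of an integration by parts
over [-n, n] are covered. *)
Lemma cvg_weighted p (e : R) : e ^+ 2 = 1 ->
  (weighted p (e * n%:R) @[n --> \oo] --> (0 : R))%classic.
Proof.
move=> e1; have [C hC] := weighted_le_gauss p.
have cg : (C * gauss_fun (n%:R : R) @[n --> \oo] --> (0 : R))%classic.
  rewrite -[X in (_ --> X)%classic](mulr0 C); apply: cvgMr.
  exact: (cvg_comp _ _ (@cvgr_idn R) cvg_gauss_fun).
apply: norm_cvg0; apply: (@squeeze_cvgr _ _ _ _ (cst 0) (fun n => C * gauss_fun (n%:R : R))).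
- near=> n; rewrite normr_ge0 /=; apply: le_trans (hC _) _.
  by rewrite /gauss_fun exprMn e1 mul1r.
- exact: cvg_cst.
- exact: cg.
Unshelve. all: by end_near. Qed.

End Weight.

Section Truncation.
Context {R : realType}.
Local Notation mu := (@lebesgue_measure R).
Local Open Scope classical_set_scope.

(** Reduces statements about the integral over the line to bounded intervals,
where substitution and the fundamental theorem of calculus apply to functions
of any sign. *)
Lemma cvg_Rintegral_itvNnn (f : R -> R) : mu.-integrable setT (EFin \o f) ->
  \int[mu]_(x in `[- (n%:R : R), n%:R]) f x @[n --> \oo] --> \int[mu]_x f x.
Proof.
move=> intf; have mf := measurable_int mu intf.
have inf : (\int[mu]_x (f x)%:E)%E \is a fin_num by exact: integrable_fin_num intf.
apply: fine_cvg; rewrite /Rintegral fineK//.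
pose f_ n := (EFin \o f) \_ `[- (n%:R : R), n%:R].
have [] := @dominated_convergence _ _ _ mu _ measurableT f_ (EFin \o f)
  (EFin \o (Num.norm \o f)) _ mf _ _ _.
- move=> n; apply/(measurable_restrictT _ _).1 => //.
  exact: measurable_funTS.
- apply/aeW => x _; apply: cvg_near_cst; near=> n.
  rewrite /f_ patchE mem_set//= in_itv/= -ler_norml.
  near: n; exact: nbhs_infty_ger.
- exact: integrable_norm.
- apply/aeW => x n _; rewrite /f_ patchE; case: ifP => //= _.
  by rewrite normr0 lee_fin.
move=> _ _; under eq_fun do rewrite -integral_mkcond.
by [].
Unshelve. all: by end_near. Qed.

End Truncation.

(** * The weighted integral as a functional on polynomials *)

(** The derivative of V = x^4 - 2 t x^2, where the weight is exp(-V). *)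
Definition potential' {R : realType} (t : R) : {poly R} := 4 *: 'X^3 - (4 * t) *: 'X.

Definition positive_functional {R : realType} (L : {poly R} -> R) : Prop :=
  (forall (a : R) p q, L (a *: p + q) = a * L p + L q) /\
  (forall p, p != 0 -> 0 < L (p * p)).

Definition even_functional {R : realType} (L : {poly R} -> R) : Prop :=
  forall p, L (p \Po - 'X) = L p.

(** Integration by parts against the weight exp(-V), without boundary terms. *)
Definition freud_functional {R : realType} (t : R) (L : {poly R} -> R) : Prop :=
  forall p, L p^`() = L (potential' t * p).

Lemma finite_root {F : idomainType} (p : {poly F}) :
  p != 0 -> finite_set [set x | root p x]%classic.
Proof.
move=> p0; apply: contrapT => /(@infinite_set_fset _ _ (size p)) [B BZ].
apply/negP; rewrite -ltnNge; apply: max_poly_roots p0 _ (finmap.fset_uniq B).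
by apply/allP => x xB; exact: BZ.
Qed.

Section WeightedIntegral.
Context {R : realType}.
Variable t : R.
Implicit Types (p q : {poly R}) (x : R).
Local Notation mu := (@lebesgue_measure R).
Local Open Scope classical_set_scope.

Definition weighted_integral p : R := \int[mu]_x weighted t p x.

Lemma ipE p q : ip t p q = weighted_integral (p * q).
Proof. by apply: eq_Rintegral => x _; rewrite /weighted hornerM. Qed.

Lemma weighted_integral_linear (a : R) p q :
  weighted_integral (a *: p + q) = a * weighted_integral p + weighted_integral q.
Proof.
have ip := integrable_weighted t p; have iq := integrable_weighted t q.
rewrite /weighted_integral -RintegralZl// -RintegralD//; last first.
  by apply: eq_integrable (integrableZl measurableT a ip).
by apply: eq_Rintegral => x _; rewrite /weighted hornerD hornerZ mulrDl mulrA.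
Qed.

(** If the integral vanished, p^2 w would vanish almost everywhere, and the line
would be the union of a null set and the finite set of roots of p. *)
Lemma weighted_integral_gt0 p : p != 0 -> 0 < weighted_integral (p * p).
Proof.
move=> p0.
have nneg x : 0 <= weighted t (p * p) x.
  by rewrite /weighted hornerM mulr_ge0 ?expR_ge0// -expr2 sqr_ge0.
rewrite lt_neqAle Rintegral_ge0// andbT eq_sym; apply/eqP => int0.
have ipp := integrable_weighted t (p * p).
have mpp := measurable_int mu ipp.
have abs0 : (\int[mu]_x `|(EFin \o weighted t (p * p)) x| = 0)%E.
  under eq_integral do rewrite /= ger0_norm//.
  by rewrite -(fineK (integrable_fin_num measurableT ipp)); congr EFin.
have [N [mN N0 subN]] := (ae_eq_integral_abs mu measurableT mpp).1 abs0.
pose Z := [set x | root p x].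
have cZ : countable Z by exact/finite_set_countable/finite_root.
have mZ : measurable Z by exact: countable_measurable cZ.
have Z0 : mu Z = 0%E by exact: countable_lebesgue_measure0.
have : mu [set: R] = 0%E.
  apply: (subset_measure0 (B := N `|` Z)) => //.
  - exact: measurableU.
  - move=> x _; have [rx|nrx] := boolP (root p x); [by right|left].
    apply: subN => /= /(_ I) [] /eqP.
    by rewrite /weighted hornerM !mulf_eq0 orbb (gt_eqF (expR_gt0 _)) orbF -rootE (negPf nrx).
  - exact: null_set_setU.
by rewrite -set_itvNyy lebesgue_measure_itv.
Qed.

Lemma weighted_integral_pos : positive_functional weighted_integral.
Proof. by split; [exact: weighted_integral_linear|exact: weighted_integral_gt0]. Qed.

Lemma weighted_integral_comp_oppX p :
  weighted_integral (p \Po - 'X) = weighted_integral p.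
Proof.
have refl (n : nat) : \int[mu]_(x in `[- (n%:R : R), n%:R]) weighted t (p \Po - 'X) x =
    \int[mu]_(x in `[- (n%:R : R), n%:R]) weighted t p x.
  have n0 : - n%:R <= n%:R :> R by rewrite (@le_trans _ _ 0) ?oppr_le0.
  rewrite /Rintegral; congr fine.
  have := @integration_by_substitution_oppr _ (weighted t p) _ _ n0.
  rewrite opprK => ->; last first.
    by apply: continuous_subspaceT; exact: continuous_weighted.
  apply: eq_integral => x _; congr EFin.
  rewrite /weighted /weight /= horner_comp hornerN hornerX.
  by congr (_ * expR _); ring.
have c1 := cvg_Rintegral_itvNnn _ (integrable_weighted t p).
have c2 := cvg_Rintegral_itvNnn _ (integrable_weighted t (p \Po - 'X)).
apply: (cvg_unique _ _ c1) => //.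
by apply: cvg_trans c2; apply: near_eq_cvg; apply: nearW => n; rewrite refl.
Qed.

Lemma is_derive_weighted p x :
  is_derive x 1 (weighted t p) (weighted t (p^`() - potential' t * p) x).
Proof.
have -> : weighted t p = (horner p * (expR \o horner (- 'X^4 + (2 * t) *: 'X^2)))%R.
  by rewrite -weightE.
apply: is_derive_eq; rewrite -[expR _]/((expR \o horner _) x) -weightE.
rewrite /weighted /potential' derivD derivN derivZ !derivXn.
rewrite !(hornerD, hornerN, hornerM, hornerZ, hornerMn, hornerXn, hornerX) /GRing.scale /=.
ring.
Qed.

(** (p w)' = (p' - V' p) w integrates over [-n, n] to p w at n minus p w at -n,
which tends to 0. *)
Lemma weighted_integral_deriv p :
  weighted_integral p^`() = weighted_integral (potential' t * p).
Proof.
apply/eqP; rewrite -subr_eq0 -mulN1r addrC -weighted_integral_linear.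
rewrite scaleN1r addrC; apply/eqP.
have c1 := cvg_Rintegral_itvNnn _ (integrable_weighted t (p^`() - potential' t * p)).
have c2 : (weighted t p n%:R - weighted t p (- n%:R)) @[n --> \oo] --> (0 : R).
  rewrite -[X in _ --> X](subr0 0); apply: cvgB.
    by have := cvg_weighted t p 1 (expr1n _ _); under eq_fun do rewrite mul1r.
  by have := cvg_weighted t p (-1) (sqrr_sign _ 1); under eq_fun do rewrite mulN1r.
apply: (cvg_unique _ c1) => //.
apply: cvg_trans c2; apply: near_eq_cvg; near=> n.
have n0 : - n%:R < n%:R :> R.
  by rewrite (lt_trans (_ : _ < 0)) ?oppr_lt0 ?ltr0n//; near: n; exact: nbhs_infty_gt.
rewrite /Rintegral (@continuous_FTC2 _ _ (weighted t p))//.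
- apply: continuous_subspaceT; exact: continuous_weighted.
- split.
  + by move=> x _; have [] := is_derive_weighted p x.
  + by apply: cvg_at_right_filter; exact: continuous_weighted.
  + by apply: cvg_at_left_filter; exact: continuous_weighted.
- by move=> x _; rewrite derive1E; have [_ ->] := is_derive_weighted p x.
Unshelve. all: by end_near. Qed.

End WeightedIntegral.

(** * Monic orthogonal polynomials of a positive functional *)

Lemma size_polyB_leq {R : nzRingType} {p q : {poly R}} {n} :
  (size p <= n)%N -> (size q <= n)%N -> (size (p - q)%R <= n)%N.
Proof.
move=> sp sq; apply: leq_trans (size_polyD _ _) _.
by rewrite size_polyN geq_max sp.
Qed.

Lemma size_polyXM_leq {R : nzRingType} {p : {poly R}} {n} :
  (size p <= n)%N -> (size ('X * p)%R <= n.+1)%N.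
Proof. by move=> sp; apply: leq_trans (size_polyMleq _ _) _; rewrite size_polyX. Qed.

Section OrthogonalPolynomials.
Local Set Implicit Arguments.
Local Unset Strict Implicit.
Context {R : realType}.
Implicit Types (p q r : {poly R}).
Variables (L : {poly R} -> R) (F : nat -> {poly R}).
Hypothesis L_pos : positive_functional L.
Hypothesis F_mo : monic_orthogonal (fun p q => L (p * q)) F.

Let L_linear : forall (a : R) p q, L (a *: p + q) = a * L p + L q := L_pos.1.
Let L_gt0 : forall p, p != 0 -> 0 < L (p * p) := L_pos.2.
Let F_monic : forall n, F n \is monic /\ size (F n) = n.+1 := F_mo.1.
Let F_orth : forall k n, k != n -> L (F k * F n) = 0 := F_mo.2.

Definition op_norm2 n := L (F n * F n).

Definition recurrence_coef n := if n is k.+1 then op_norm2 k.+1 / op_norm2 k else 0.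

Lemma functional0 : L 0 = 0.
Proof. by have := L_linear (-1) 0 0; rewrite scaler0 addr0 mulN1r addNr. Qed.

Lemma functionalZ a p : L (a *: p) = a * L p.
Proof. by rewrite -[a *: p]addr0 L_linear functional0 addr0. Qed.

Lemma functionalZl a p q : L (a *: p * q) = a * L (p * q).
Proof. by rewrite -scalerAl functionalZ. Qed.

Lemma functionalZr a p q : L (p * (a *: q)) = a * L (p * q).
Proof. by rewrite -scalerAr functionalZ. Qed.

Lemma functionalD p q : L (p + q) = L p + L q.
Proof. by rewrite -[p]scale1r L_linear mul1r scale1r. Qed.

Lemma functionalB p q : L (p - q) = L p - L q.
Proof. by rewrite functionalD -scaleN1r functionalZ mulN1r. Qed.

Lemma op_norm2_gt0 n : 0 < op_norm2 n.
Proof. by apply: L_gt0; rewrite -size_poly_eq0 (F_monic n).2. Qed.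

Lemma op_norm2_neq0 n : op_norm2 n != 0.
Proof. exact: lt0r_neq0 (op_norm2_gt0 n). Qed.

Lemma op_norm2S n : op_norm2 n.+1 = recurrence_coef n.+1 * op_norm2 n.
Proof. by rewrite /= divfK ?op_norm2_neq0. Qed.

Lemma op_coef_lead n : (F n)`_n = 1.
Proof. by have [/monicP + sF] := F_monic n; rewrite lead_coefE sF. Qed.

Lemma size_op n : size (F n) = n.+1.
Proof. exact: (F_monic n).2. Qed.

Lemma size_sub_op n q : (size q <= n.+1)%N -> (size (q - q`_n *: F n)%R <= n)%N.
Proof.
move=> sq; apply/leq_sizeP => j; rewrite coefB coefZ leq_eqVlt => /predU1P[<-|nj].
  by rewrite op_coef_lead mulr1 subrr.
rewrite nth_default ?(leq_trans sq)// [(F n)`_j]nth_default ?size_op//.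
by rewrite mulr0 subr0.
Qed.

(** The F_k with k < n span the polynomials of degree less than n: subtracting
multiples of F_(s), F_(s-1), ... from q lowers its degree step by step. *)
Lemma orth_lower n q : (size q <= n)%N -> L (q * F n) = 0.
Proof.
suff H s : (s <= n)%N -> forall q, (size q <= s)%N -> L (q * F n) = 0 by exact: H.
elim: s => [_ {}q|s IH sn {}q sq].
  by rewrite leqn0 size_poly_eq0 => /eqP ->; rewrite mul0r functional0.
rewrite -[q](subrK (q`_s *: F s)) mulrDl functionalD IH ?(ltnW sn) ?size_sub_op// add0r.
by rewrite functionalZl F_orth ?mulr0// ltn_eqF.
Qed.

Lemma orth_top n q : (size q <= n.+1)%N -> L (q * F n) = q`_n * op_norm2 n.
Proof.
move=> sq; rewrite -[q in LHS](subrK (q`_n *: F n)) mulrDl functionalD.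
by rewrite orth_lower ?size_sub_op// add0r functionalZl.
Qed.

(** The principle behind the recurrence and the ladder relation: the difference
of the two sides has degree less than n and is orthogonal to all polynomials of
degree less than n, in particular to itself. *)
Lemma orth_all_eq0 n r : (size r <= n)%N ->
  (forall q, (size q <= n)%N -> L (q * r) = 0) -> r = 0.
Proof.
move=> sr H; apply/eqP; apply: contraT => /L_gt0.
by rewrite H ?ltxx.
Qed.

Lemma orth_lower_scale n r : (size r <= n.+1)%N ->
  (forall q, (size q <= n)%N -> L (q * r) = 0) -> r = r`_n *: F n.
Proof.
move=> sr H; apply/eqP; rewrite -subr_eq0; apply/eqP.
apply: (@orth_all_eq0 n) (size_sub_op sr) _ => q sq.
by rewrite mulrBr functionalB H// functionalZr orth_lower// mulr0 subr0.
Qed.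

(** The reproducing property of the kernel: it recovers p(y) when deg p < n. *)
Lemma fourier_expansion n p y : (size p <= n)%N ->
  \sum_(k < n) L (p * F k) * (F k).[y] / op_norm2 k = p.[y].
Proof.
elim: n p => [|n IH] p sp.
  by move: sp; rewrite leqn0 size_poly_eq0 big_ord0 => /eqP ->; rewrite horner0.
rewrite big_ord_recr /= orth_top// -[p in RHS](subrK (p`_n *: F n)) hornerD.
rewrite -(IH _ (size_sub_op sp)) hornerZ; congr (_ + _).
  apply: eq_bigr => k _; rewrite mulrBl functionalB functionalZl F_orth.
    by rewrite mulr0 subr0.
  by rewrite gtn_eqF.
by rewrite [_ * op_norm2 n * _]mulrAC mulfK ?op_norm2_neq0//.
Qed.

(** If y_i = y_j = a with i != j, then F_n = (X - a)^2 P with deg P < n, and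
orthogonality to P says that the square of (X - a) P has value 0. *)
Lemma op_zeros_inj n (y : 'I_n -> R) :
  F n = \prod_(i < n) ('X - (y i)%:P) -> injective y.
Proof.
move=> Fy i j yij; apply/eqP; apply: contraT => ij.
have := Fy; rewrite (bigD1 i)//= (bigD1 j)//=; last by rewrite eq_sym.
rewrite -yij; set P := \prod_(_ | _) _ => FP.
have [P0 X0] : P != 0 /\ 'X - (y i)%:P != 0.
  by split; apply/eqP => E; have := size_op n; rewrite FP E ?(mulr0, mul0r) size_poly0.
have sP : (size P <= n)%N.
  have := size_op n; rewrite FP !size_mul ?mulf_neq0// !size_XsubC => -[<-].
  exact: leqnSn.
have := orth_lower sP; rewrite FP.
have -> : P * (('X - (y i)%:P) * (('X - (y i)%:P) * P)) =
  (('X - (y i)%:P) * P) * (('X - (y i)%:P) * P) by ring.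
by move=> /eqP; rewrite gt_eqF// L_gt0 ?mulf_neq0.
Qed.

Section Even.
Hypothesis L_even : even_functional L.

(** F_n(-x) is orthogonal to all lower degrees because L is even, hence a
multiple of F_n; the leading coefficient gives the factor. *)
Lemma op_parity n : F n \Po - 'X = (-1) ^+ n *: F n.
Proof.
have sX : size (- 'X : {poly R}) = 2 by rewrite size_polyN size_polyX.
have sz p : size (p \Po - 'X) = size p.
  have [->|p0] := eqVneq p 0; first by rewrite comp_poly0.
  by rewrite size_comp_poly2.
have cXX p : p \Po - 'X \Po - 'X = p.
  by rewrite -comp_polyA raddfN /= comp_polyX opprK comp_polyXr.
rewrite (@orth_lower_scale n (F n \Po - 'X)) ?sz ?size_op//; last first.
  move=> q sq; rewrite -L_even comp_polyM cXX orth_lower ?sz//.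
congr (_ *: _).
have : lead_coef (F n \Po - 'X) = (-1) ^+ n.
  rewrite lead_coef_comp ?sX// lead_coefN lead_coefX (monicP (F_monic n).1) mul1r.
  by rewrite size_op.
by rewrite lead_coefE sz size_op.
Qed.

Lemma op_odd_eval0 n : odd n -> (F n).[0] = 0.
Proof.
move=> on; have := congr1 (horner^~ 0) (op_parity n).
rewrite horner_comp hornerN hornerX oppr0 hornerZ -signr_odd on expr1 mulN1r.
by move/eqP; rewrite -addr_eq0 -mulr2n mulrn_eq0 => /eqP.
Qed.

Lemma functional_XFF n : L ('X * F n * F n) = 0.
Proof.
have := L_even ('X * F n * F n); rewrite !comp_polyM op_parity comp_polyX.
rewrite -scalerAr -scalerAr -scalerAl scalerA -expr2 sqrr_sign scale1r.
rewrite !mulNr -scaleN1r functionalZ mulN1r => /eqP.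
by rewrite eq_sym -addr_eq0 -mulr2n mulrn_eq0 => /eqP.
Qed.

(** The difference of the two sides has degree at most n.  Against F_n it
vanishes because x F_n^2 is odd, and against lower degrees because
a_n^2 |F_(n-1)|^2 = |F_n|^2.  At n = 0 the predecessor convention F_(-1) = F_0 is
harmless since a_0^2 = 0. *)
Lemma recurrence n : 'X * F n = F n.+1 + recurrence_coef n *: F n.-1.
Proof.
apply/eqP; rewrite -subr_eq0 opprD addrA; apply/eqP; apply: (@orth_all_eq0 n.+1).
  apply: size_polyB_leq.
    have := @size_sub_op n.+1 ('X * F n) (size_polyXM_leq _).
    by rewrite size_op coefXM op_coef_lead scale1r; exact.
  by apply: leq_trans (size_scale_leq _ _) _; rewrite size_op ltnS leq_pred.
move=> q sq.
rewrite !mulrBr !functionalB (orth_lower sq) subr0 functionalZr.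
have [q' [c [-> sq']]] : exists q' c, q = q' + c *: F n /\ (size q' <= n)%N.
  by exists (q - q`_n *: F n), q`_n; rewrite subrK size_sub_op.
rewrite mulrDl functionalD functionalZl [F n * _]mulrCA [_ * (F n * F n)]mulrA.
rewrite functional_XFF mulr0 addr0 mulrDl functionalD functionalZl.
rewrite mulrA [q' * 'X]mulrC (@orth_top n ('X * q')) ?size_polyXM_leq//.
case: n {sq} sq' => [|n] sq' /=; first by rewrite coefXM mul0r sub0r !mul0r oppr0.
rewrite coefXM /= -[_ / _]/(recurrence_coef n.+1) op_norm2S.
rewrite (@F_orth n.+1 n) ?gtn_eqF// mulr0 addr0 (orth_top sq').
by ring.
Qed.

(** The recurrence at the origin reads F_(n+1)(0) = - a_n^2 F_(n-1)(0). *)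
Lemma op_even_eval0_neq0 m : (F (2 * m)).[0] != 0.
Proof.
elim: m => [|m IH].
  have s1 := size_op 0; have := op_coef_lead 0.
  rewrite muln0 (size1_polyC (eq_leq s1)) coefC eqxx hornerC => ->; exact: oner_neq0.
have := congr1 (horner^~ 0) (recurrence (2 * m).+1).
rewrite mulnS addSn hornerM hornerX mul0r hornerD hornerZ => /esym/eqP.
rewrite addr_eq0 => /eqP ->; rewrite oppr_eq0 mulf_neq0//=.
by rewrite mulf_neq0 ?invr_eq0 ?op_norm2_neq0.
Qed.

Section Freud.
Variable t : R.
Hypothesis L_deriv : freud_functional t L.

(** Write a, a' for a_(n+1)^2, a_(n+2)^2.  Both sides have degree at most n: on
the right x^2 F_n - x F_(n+1) = a_n^2 x F_(n-1).  It remains to compare them as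
functionals on polynomials q of degree at most n.  By parts, L (q F_(n+1)') =
L (V' q F_(n+1)), and x F_(n+1) = F_(n+2) + a F_n turns the difference of the two
sides into a combination of L ((x^2 - t) q F_(n+2)), L (x q F_(n+1)) and L (q F_n),
each of which only sees the coefficient of x^n in q. *)
Lemma ladder n : (F n.+1)^`() =
  (4 * recurrence_coef n.+1) *:
    (('X^2 + (recurrence_coef n.+1 + recurrence_coef n.+2 - t)%:P) * F n
     - 'X * F n.+1).
Proof.
set a := recurrence_coef n.+1; set a' := recurrence_coef n.+2.
apply/eqP; rewrite -subr_eq0; apply/eqP; apply: (@orth_all_eq0 n.+1).
  apply: size_polyB_leq.
    by rewrite -ltnS -(size_op n.+1) lt_size_deriv// -size_poly_eq0 size_op.
  have -> : ('X^2 + (a + a' - t)%:P) * F n - 'X * F n.+1 =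
      (recurrence_coef n *: ('X * F n.-1)) - (t - a - a') *: F n.
    have := recurrence n; rewrite -!mul_polyC => rec.
    have -> : F n.+1 = 'X * F n - (recurrence_coef n)%:P * F n.-1 by rewrite rec addrK.
    by ring.
  apply: leq_trans (size_scale_leq _ _) _; apply: size_polyB_leq.
    case: n @a @a' => [|n] _ _ /=; first by rewrite scale0r size_poly0.
    by apply: leq_trans (size_scale_leq _ _) _; rewrite size_polyXM_leq ?size_op.
  by apply: leq_trans (size_scale_leq _ _) _; rewrite size_op.
move=> q sq.
have sdq : (size q^`() <= n.+1)%N.
  have [->|q0] := eqVneq q 0; first by rewrite deriv0 size_poly0.
  exact: leq_trans (ltnW (lt_size_deriv q0)) sq.
have LF' : L (q * (F n.+1)^`()) = L (potential' t * (q * F n.+1)).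
  rewrite -L_deriv derivM functionalD orth_lower ?add0r//.
rewrite mulrBr functionalB LF' -functionalB.
have -> : potential' t * (q * F n.+1) -
    q * ((4 * a) *: (('X^2 + (a + a' - t)%:P) * F n - 'X * F n.+1)) =
  4 *: (('X * ('X * q) - t *: q) * F n.+2 + a *: (('X * q) * F n.+1)
    - (a * (a + a')) *: (q * F n)).
  rewrite /potential'; have := recurrence n.+1; rewrite -/a /= -!mul_polyC => rec.
  have -> : F n.+2 = 'X * F n.+1 - a%:P * F n by rewrite rec addrK.
  ring.
rewrite functionalZ functionalB functionalD functionalZ functionalZ.
rewrite (orth_top sq) (orth_top (size_polyXM_leq sq)) orth_top; last first.
  apply: size_polyB_leq; first by rewrite !size_polyXM_leq.
  by apply: leq_trans (size_scale_leq _ _) _; do 2 apply: leqW.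
rewrite coefB coefZ !coefXM /= [q`_n.+2]nth_default ?(leq_trans sq)//.
rewrite /a /a' !op_norm2S; ring.
Qed.

End Freud.
End Even.
End OrthogonalPolynomials.

(** * Adding a point mass at the origin *)

Section MassAtOrigin.
Local Set Implicit Arguments.
Local Unset Strict Implicit.
Context {R : realType}.
Implicit Types (p q : {poly R}).
Variables (L : {poly R} -> R) (M : R) (F Q : nat -> {poly R}).
Hypothesis L_pos : positive_functional L.
Hypothesis L_even : even_functional L.
Hypothesis M_ge0 : 0 <= M.
Hypothesis F_mo : monic_orthogonal (fun p q => L (p * q)) F.

Definition mass_functional p := L p + M * p.[0].

Hypothesis Q_mo : monic_orthogonal (fun p q => mass_functional (p * q)) Q.

Local Notation op_norm2 := (op_norm2 L F).
Local Notation recurrence_coef := (recurrence_coef L F).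

(** K_(n-1)(0,0): the sum has n terms. *)
Definition origin_kernel n := \sum_(k < n) (F k).[0] * (F k).[0] / op_norm2 k.

Lemma origin_kernel_ge0 n : 0 <= origin_kernel n.
Proof.
apply: sumr_ge0 => k _; rewrite divr_ge0 -?expr2 ?sqr_ge0// ltW//.
exact: (op_norm2_gt0 L_pos F_mo).
Qed.

Lemma mass_functional_pos : positive_functional mass_functional.
Proof.
split=> [a p q|p p0]; rewrite /mass_functional.
  by rewrite L_pos.1 hornerD hornerZ; ring.
rewrite ltr_wpDr ?L_pos.2// hornerM mulr_ge0// -expr2.
exact: sqr_ge0.
Qed.

(** On degrees less than n, Q_n - F_n represents a multiple of evaluation at the
origin, as K_(n-1)(x,0) does. *)
Lemma mass_op_sub_orth n q : (size q <= n)%N ->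
  L (q * (Q n - F n)) = - (M * (Q n).[0] * q.[0]).
Proof.
move=> sq; rewrite mulrBr (functionalB L_pos) (orth_lower L_pos F_mo) // subr0.
have := orth_lower mass_functional_pos Q_mo sq.
by rewrite /mass_functional hornerM => /eqP; rewrite addr_eq0 => /eqP ->; ring.
Qed.

Lemma size_mass_op_sub n : (size (Q n - F n)%R <= n)%N.
Proof.
have := @size_sub_op _ _ _ F_mo n (Q n).
by rewrite (op_coef_lead Q_mo) scale1r (size_op Q_mo); apply.
Qed.

Lemma mass_op_eval0 n : (Q n).[0] * (1 + M * origin_kernel n) = (F n).[0].
Proof.
have := fourier_expansion L_pos F_mo 0 (size_mass_op_sub n).
have -> : \sum_(k < n) L ((Q n - F n) * F k) * (F k).[0] / op_norm2 k =
    - (M * (Q n).[0] * origin_kernel n).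
  rewrite /origin_kernel mulr_sumr -sumrN; apply: eq_bigr => k _.
  by rewrite mulrC [_ * F k]mulrC mass_op_sub_orth ?(size_op F_mo)//; ring.
by rewrite hornerD hornerN => ?; lra.
Qed.

Lemma mass_op_even_eval0_neq0 m : (Q (2 * m)).[0] != 0.
Proof.
have := op_even_eval0_neq0 L_pos F_mo L_even m.
by rewrite -mass_op_eval0; apply: contraNneq => ->; rewrite mul0r.
Qed.

(** Put d = Q_(n+2) - F_(n+2).  On multiples of x the functional q |-> L (q d)
vanishes, so x d is orthogonal to all degrees up to n and is a combination of
F_(n+2) and F_(n+1).  Evaluating at the origin removes F_(n+2), and pairing
with F_(n+1) determines the other coefficient. *)
Lemma connection_formula n b : (F n.+1).[0] = 0 -> (F n.+2).[0] != 0 ->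
  b = (1 + M * origin_kernel n.+3) / (1 + M * origin_kernel n.+2) ->
  'X * Q n.+2 = 'X * F n.+2 + (recurrence_coef n.+2 * (b - 1)) *: F n.+1.
Proof.
move=> F1 F2 bE; set d := Q n.+2 - F n.+2.
have sd : (size d <= n.+2)%N := size_mass_op_sub n.+2.
set al := ('X * d)`_n.+2; set e := 'X * d - al *: F n.+2.
have eE : e = e`_n.+1 *: F n.+1.
  apply: (orth_lower_scale L_pos F_mo) => //.
    by apply: (size_sub_op F_mo) => //; exact: size_polyXM_leq.
  move=> q sq; rewrite mulrBr (functionalB L_pos) (functionalZr L_pos).
  rewrite (orth_lower L_pos F_mo)//; last exact: leqW.
  rewrite mulr0 subr0 mulrCA mulrA mass_op_sub_orth ?size_polyXM_leq//.
  by rewrite hornerM hornerX mul0r mulr0 oppr0.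
have al0 : al = 0.
  have /eqP := congr1 (horner^~ 0) eE.
  rewrite hornerZ F1 mulr0 hornerD hornerM hornerX mul0r add0r hornerN oppr_eq0 hornerZ.
  by rewrite mulf_eq0 (negPf F2) orbF => /eqP.
have Xd : 'X * d = e`_n.+1 *: F n.+1 by rewrite -eE /e al0 scale0r subr0.
have rec := recurrence L_pos F_mo L_even n.+1.
have be : e`_n.+1 * op_norm2 n.+1 = M * (Q n.+2).[0] * (F n.+2).[0].
  have -> : e`_n.+1 * op_norm2 n.+1 = L ('X * d * F n.+1).
    by rewrite Xd (functionalZl L_pos).
  have -> : 'X * d * F n.+1 = d * F n.+2 + recurrence_coef n.+1 *: (F n * d).
    have -> : F n.+2 = 'X * F n.+1 - recurrence_coef n.+1 *: F n by rewrite rec addrK.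
    by rewrite -!mul_polyC; ring.
  rewrite (functionalD L_pos) (functionalZ L_pos) (orth_lower L_pos F_mo)//.
  rewrite mass_op_sub_orth ?(size_op F_mo)//.
  have := congr1 (horner^~ 0) rec; rewrite hornerM hornerX mul0r hornerD hornerZ /=.
  by move=> /esym/eqP; rewrite addr_eq0 => /eqP ->; ring.
have K1 : 1 + M * origin_kernel n.+2 != 0.
  by rewrite lt0r_neq0// ltr_wpDr// mulr_ge0 ?origin_kernel_ge0.
have N1 := op_norm2_neq0 L_pos F_mo n.+1.
have N2 := op_norm2_neq0 L_pos F_mo n.+2.
have -> : 'X * Q n.+2 = 'X * F n.+2 + 'X * d by rewrite /d; ring.
rewrite Xd; congr (_ + _ *: _).
apply: (mulIf N1); rewrite be -mass_op_eval0 bE.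
rewrite {2}/origin_kernel big_ord_recr /= -/(origin_kernel n.+2) -mass_op_eval0.
by field; rewrite K1 N1 N2.
Qed.

End MassAtOrigin.

(** * The electrostatic equilibrium condition *)

(** Together with the next lemma, this gives Q''/Q' at a simple zero of a product
of linear factors. *)
Lemma deriv_XsubC_mul {R : comNzRingType} (p : {poly R}) (a : R) :
  (('X - a%:P) * p)^`().[a] = p.[a] /\
  (('X - a%:P) * p)^`()^`().[a] = 2 * p^`().[a].
Proof.
rewrite derivM derivXsubC mul1r derivD derivM derivXsubC mul1r.
by rewrite !(hornerXsubC, hornerD, hornerM) subrr; split; ring.
Qed.

Lemma horner_deriv_prod {R : fieldType} (I : finType) (P : pred I) (y : I -> R) (a : R) :
  (forall j, P j -> a - y j != 0) ->
  (\prod_(j | P j) ('X - (y j)%:P))^`().[a] =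
  (\prod_(j | P j) ('X - (y j)%:P)).[a] * \sum_(j | P j) (a - y j)^-1.
Proof.
move=> Pj; elim/big_rec2: _ => [|j p s /Pj ay0 IH].
  by rewrite derivC !hornerE.
rewrite derivM derivB derivX derivC subr0 mul1r hornerD !hornerM hornerXsubC IH.
by field.
Qed.

(** Abel's formula.  The vector (f, g) solves a linear system with matrix rows
(A, B) and (C, D), and (ga, de) are the coordinates of G' when (al, be) are those
of G.  If h is another solution of the scalar equation satisfied by G, the
Wronskian of G and h is W times that of the system, whose logarithmic derivative
is the trace A + D; the coefficient of G' in that equation is thus A + D + W'/W.
Elimination of f at the root proves the identity without dividing by W. *)
Lemma wronskian_at_root {R : fieldType} {f g A B C D : {poly R}}
    (al be : {poly R}) (y : R) :
  f^`() = A * f + B * g -> g^`() = C * f + D * g ->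
  let G := al * f + be * g in
  let ga := al^`() + al * A + be * C in
  let de := be^`() + al * B + be * D in
  let W := al * de - be * ga in
  G.[y] = 0 -> al.[y] != 0 ->
  al.[y] * G^`().[y] = W.[y] * g.[y] /\
  G^`()^`().[y] * W.[y] = ((A + D).[y] * W.[y] + W^`().[y]) * G^`().[y].
Proof.
move=> f' g' G ga de W G0 al0.
have G' : G^`() = ga * f + de * g.
  by rewrite /G /ga /de derivD !derivM f' g'; ring.
have G'' : G^`()^`() = ga^`() * f + de^`() * g + ga * (A * f + B * g) + de * (C * f + D * g).
  by rewrite G' derivD !derivM f' g'; ring.
have dW : W^`() = al^`() * de + al * de^`() - (be^`() * ga + be * ga^`()).
  by rewrite /W derivB !derivM.
have fE : f.[y] = - (be.[y] * g.[y]) / al.[y].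
  move: G0; rewrite /G hornerD !hornerM => /eqP; rewrite addr_eq0 => /eqP <-.
  by rewrite mulrC mulKf.
have gaE : ga.[y] = al^`().[y] + al.[y] * A.[y] + be.[y] * C.[y].
  by rewrite /ga !(hornerD, hornerM).
have deE : de.[y] = be^`().[y] + al.[y] * B.[y] + be.[y] * D.[y].
  by rewrite /de !(hornerD, hornerM).
clearbody ga de; rewrite G'' G' dW /W !(hornerD, hornerM, hornerN) gaE deE fE.
by split; field.
Qed.

Section Equilibrium.
Local Set Implicit Arguments.
Local Unset Strict Implicit.

(** The frame with n + 2 in place of 2m, n even, and b for b_(n+2): the successors
make F_(n+1) and a_(n+1)^2 available without a case analysis. *)
Lemma equilibrium (R : realType) (L : {poly R} -> R) (t M : R)
    (F Q : nat -> {poly R}) (n : nat) (y : 'I_n.+2 -> R) (b : R) :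
  positive_functional L -> even_functional L -> freud_functional t L -> 0 <= M ->
  monic_orthogonal (fun p q => L (p * q)) F ->
  monic_orthogonal (fun p q => mass_functional L M (p * q)) Q ->
  ~~ odd n ->
  Q n.+2 = \prod_(i < n.+2) ('X - (y i)%:P) ->
  b = (1 + M * origin_kernel L F n.+3) / (1 + M * origin_kernel L F n.+2) ->
  let a1 := recurrence_coef L F n.+1 in
  let a2 := recurrence_coef L F n.+2 in
  let a3 := recurrence_coef L F n.+3 in
  let u := (4 * b) *: 'X^4 + (4 * ((a2 * b - t) * b + a3)) *: 'X^2 +
     ((4 * a2 * (a2 + a1 - t) * (b - 1) - 1) * (b - 1))%:P in
  forall i, [/\ forall j, j != i -> y j - y i != 0, u.[y i] != 0, y i != 0 &
    \sum_(j < n.+2 | j != i) (y j - y i)^-1 + 2^-1 * (u^`().[y i] / u.[y i])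
      - (y i)^-1 + 2 * (y i ^+ 3 - t * y i) = 0].
Proof.
move=> Lp Le Ld M0 Fm Qm en Qy hb a1 a2 a3 u i.
have yij j : j != i -> y j - y i != 0.
  rewrite subr_eq0; apply: contra_neq.
  exact: (op_zeros_inj (mass_functional_pos Lp M0) Qm Qy).
have nE : n.+2 = (2 * (n./2).+1)%N.
  by rewrite mulnS mul2n -[in LHS](odd_double_half n) (negPf en).
have F2 : (F n.+2).[0] != 0 by rewrite nE; exact: (op_even_eval0_neq0 Lp Fm Le).
have Q2 : (Q n.+2).[0] != 0.
  by rewrite nE; exact: (mass_op_even_eval0_neq0 Lp Le M0 Fm Qm).
have F1 : (F n.+1).[0] = 0 by apply: (op_odd_eval0 Lp Fm Le); rewrite /= en.
set x := y i in yij *.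
set P := \prod_(j < n.+2 | j != i) ('X - (y j)%:P).
have QP : Q n.+2 = ('X - x%:P) * P by rewrite Qy (bigD1 i).
have x0 : x != 0.
  by apply: contraNneq Q2 => x0; rewrite QP hornerM hornerXsubC x0 subrr mul0r.
have xyj j : j != i -> x - y j != 0 by move=> /yij; rewrite -opprB oppr_eq0.
have P0 : P.[x] != 0.
  rewrite horner_prod; apply/prodf_neq0 => j ji; rewrite hornerXsubC; exact: xyj.
have [Q1x Q2x] := deriv_XsubC_mul P x.
rewrite -QP horner_deriv_prod// -/P in Q1x Q2x.
pose S := \sum_(j < n.+2 | j != i) (y j - x)^-1.
have SE : \sum_(j < n.+2 | j != i) (x - y j)^-1 = - S.
  by rewrite -sumrN; apply: eq_bigr => j _; rewrite -invrN opprB.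
rewrite SE in Q2x.
have a20 : a2 != 0.
  by rewrite mulf_neq0 ?invr_eq0//; exact: (op_norm2_neq0 Lp Fm).
have := connection_formula Lp Le M0 Fm Qm F1 F2 hb.
rewrite -/a2 -mul_polyC => XQ.
have f' := ladder Lp Fm Le Ld n.+1.
have g' := ladder Lp Fm Le Ld n.
have rec := recurrence Lp Fm Le n.+1.
rewrite -/a1 -/a2 -/a3 in f' g' rec.
(* The system for (F_(n+2), F_(n+1)); F_n is eliminated by the recurrence. *)
pose A : {poly R} := - ((4 * a2) *: 'X).
pose B : {poly R} := (4 * a2) *: ('X^2 + (a2 + a3 - t)%:P).
pose C : {poly R} := - (4 *: ('X^2 + (a1 + a2 - t)%:P)).
pose D : {poly R} := 4 *: ('X * ('X^2 + (a1 + a2 - t)%:P)) - (4 * a1) *: 'X.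
have f'E : (F n.+2)^`() = A * F n.+2 + B * F n.+1.
  by rewrite f' /A /B -!mul_polyC; ring.
have g'E : (F n.+1)^`() = C * F n.+2 + D * F n.+1.
  have -> : F n.+2 = 'X * F n.+1 - a1 *: F n by rewrite rec addrK.
  by rewrite g' /C /D -!mul_polyC; ring.
have [] := wronskian_at_root 'X (a2 * (b - 1))%:P x f'E g'E.
- by rewrite -XQ QP !hornerM hornerXsubC subrr mul0r mulr0.
- by rewrite hornerX.
set W := 'X * _ - _.
have WE : W = a2 *: u.
  rewrite /W /u derivX derivC /A /B /C /D -!mul_polyC.
  by ring.
have ADx : (A + D).[x] = 4 * x ^+ 3 - 4 * t * x.
  rewrite /A /D !(hornerD, hornerN, hornerZ, hornerM, hornerX, hornerC, hornerXn).
  by ring.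
have G1 : ('X * Q n.+2)^`().[x] = x * P.[x].
  rewrite derivM derivX mul1r hornerD hornerM hornerX Q1x.
  by rewrite QP hornerM hornerXsubC subrr mul0r add0r.
have G2 : ('X * Q n.+2)^`()^`().[x] = 2 * P.[x] - 2 * x * P.[x] * S.
  rewrite derivM derivX mul1r derivD derivM derivX mul1r !(hornerD, hornerM, hornerX).
  by rewrite Q1x Q2x; ring.
rewrite WE -XQ ADx G1 G2 derivZ !hornerZ hornerX => E1 E2.
have u0 : u.[x] != 0.
  apply/eqP => u0; move: E1; rewrite u0 mulr0 mul0r => /eqP.
  by rewrite !mulf_eq0 (negPf x0) (negPf P0).
split=> //; rewrite -/S.
(* Solves the differential equation E2 at x for u'(x). *)
have -> : u^`().[x] = ((2 - 2 * x * S) - (4 * x ^+ 3 - 4 * t * x) * x) * u.[x] / x.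
  apply: (mulfI (mulf_neq0 a20 (mulf_neq0 x0 P0))).
  transitivity (a2 * u^`().[x] * (x * P.[x])); first by ring.
  have -> : a2 * u^`().[x] * (x * P.[x]) = (2 * P.[x] - 2 * x * P.[x] * S) * (a2 * u.[x])
     - (4 * x ^+ 3 - 4 * t * x) * (a2 * u.[x]) * (x * P.[x]) by rewrite E2; ring.
  by field.
by field; rewrite x0 u0.
Qed.

End Equilibrium.

Theorem mainTheorem4 (R : realType) (t M : R) (m : nat)
    (F Q : nat -> {poly R}) (y : 'I_(2 * m)%N -> R)
    (t_gt0 : 0 < t) (M_gt0 : 0 < M) (m_ge1 : (1 <= m)%N)
    (hF : monic_orthogonal (ip t) F)
    (hQ : monic_orthogonal (ip_mass t M) Q)
    (hy : Q (2 * m)%N = \prod_(i < (2 * m)%N) ('X - (y i)%:P)) :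
  forall i : 'I_(2 * m)%N,
    [/\ forall j : 'I_(2 * m)%N, j != i -> y j - y i != 0,
        (upoly t M F (2 * m)%N).[y i] != 0,
        y i != 0
      & \sum_(j < (2 * m)%N | j != i) (y j - y i)^-1
        + 2^-1 * ((upoly t M F (2 * m)%N)^`().[y i]
                  / (upoly t M F (2 * m)%N).[y i])
        - (y i)^-1
        + 2 * (y i ^+ 3 - t * y i) = 0].
Proof.
have mass_ip p q : ip_mass t M p q = mass_functional (weighted_integral t) M (p * q).
  by rewrite /ip_mass /mass_functional ipE hornerM mulrA.
have Fm : monic_orthogonal (fun p q => weighted_integral t (p * q)) F.
  by split=> [|k n kn]; [exact: hF.1 | rewrite -ipE; exact: hF.2].
have Qm : monic_orthogonal (fun p q => mass_functional (weighted_integral t) M (p * q)) Q.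
  by split=> [|k n kn]; [exact: hQ.1 | rewrite -mass_ip; exact: hQ.2].
have asqE n : asq t F n = recurrence_coef (weighted_integral t) F n.
  by case: n => //= n; rewrite /sqnorm !ipE.
have kernelE n : Defs.kernel t F n 0 0 = origin_kernel (weighted_integral t) F n.+1.
  by apply: eq_bigr => k _; rewrite /sqnorm ipE.
have mE : (2 * m = (2 * m.-1).+2)%N by rewrite -[in LHS](prednK m_ge1) mulnS.
move: y hy; rewrite mE => y hy i.
rewrite /upoly /hcoef !asqE.
apply: (equilibrium (weighted_integral_pos t) (weighted_integral_comp_oppX t)
  (weighted_integral_deriv t) (ltW M_gt0) Fm Qm) => //; first by rewrite oddM.
by rewrite /bcoef !kernelE.
Qed.
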